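(* Let $k>0$. Let $p,q\in\mathcal{P}$ be such that $q_{i'j'}>p_{i'j'}$ for one pair $(i',j')\in n\times n$ and $q_{ij}=p_{ij}$ for all $(i,j)\in (n\times n)\setminus\{(i',j')\}$. Then $(elo_k(q))_{i'}>(elo_k(p))_{i'}$ and $(elo_k(q))_{j'}<(elo_k(p))_{j'}$.
   Context: Fix $n\in\mathbb{N}$ with $n\geq 2$ and identify $n=\{0,1,\dots,n-1\}$ (so $i\in n$ means $0\le i\le n-1$). The rating space is $\mathcal{R}:=\{x\in\mathbb{R}^n\mid\sum_{i\in n}x_i=0\}$. The space of competition results is $\mathcal{P}:=\{p\in\mathbb{R}^{n\times n}\mid p_{ij}\geq 0\text{ for all }i,j\in n,\ p_{ii}=0\text{ for all }i\in n\}$. For $k>0$, the classical Elo map is $$elo_k^{cl}:\mathcal{R}\times\mathcal{P}\rightarrow\mathcal{R},\quad (x,p)\mapsto k\cdot\left(\sum_{j\in n}\left(p_{ij}-\frac{p_{ij}+p_{ji}}{1+\exp(x_j-x_i)}\right)\right)_{i\in n}.$$ For every $k>0$ and $p\in\mathcal{P}$ there is exactly one $x\in\mathcal{R}$ with $x=elo_k^{cl}(x,p)$; it is denoted $elo_k(p)$ (the self-justifying rating with respect to $p$ and $k$). *)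

(* Defs.v *)
From mathcomp Require Import all_boot all_order all_algebra.
From mathcomp Require Import all_classical all_reals all_analysis.

Set Implicit Arguments.
Unset Strict Implicit.
Unset Printing Implicit Defensive.

Import Order.TTheory GRing.Theory Num.Theory.

Local Open Scope classical_set_scope.
Local Open Scope ring_scope.

Definition rating_space (R : realType) (n : nat) : set 'rV[R]_n :=
  [set x | \sum_(i < n) x 0 i = 0].

Definition result_space (R : realType) (n : nat) : set 'M[R]_n :=
  [set p | (forall i j, 0 <= p i j) /\ (forall i, p i i = 0)].

Arguments rating_space : clear implicits.
Arguments result_space : clear implicits.

Definition elo_cl (R : realType) (n : nat) (k : R) (x : 'rV[R]_n)
    (p : 'M[R]_n) : 'rV[R]_n :=
  k *: \row_(i < n) \sum_(j < n)
         (p i j - (p i j + p j i) / (1 + expR (x 0 j - x 0 i))).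

(* [xget 0 A] is an element of [A] whenever [A] is nonempty.  For [0 < k] and
   [p] in [result_space R n] the set below is a singleton, so the default
   value 0 plays no role there. *)
Definition elo (R : realType) (n : nat) (k : R) (p : 'M[R]_n) : 'rV[R]_n :=
  xget 0 [set x | rating_space R n x /\ x = elo_cl k x p].

(* Main.v *)
(** Existence of the fixed point: the relaxed map [x |-> (1 - t) x + t elo_cl x]
    is a contraction of ratio [1 - t] for the sup norm when [t] is small, because
    the logistic function is nondecreasing and 1-Lipschitz, so that its increments
    enter as a convex combination of the coordinate differences.

    Comparison: by the same slopes, [d = elo q - elo p] solves
    [d i = r i - \sum_j w i j (d i - d j)] with [w >= 0], where the source [r] is
    positive at [i'], negative at [j'] and zero elsewhere.  A maximum principle
    together with [\sum_i d i = 0] gives the sign of [d] at [i'] and at [j']. *)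
From HB Require Import structures.
Require Import Defs.
From mathcomp Require Import all_boot all_order all_algebra.
From mathcomp Require Import all_classical all_reals all_analysis.
From mathcomp Require Import ring lra.

Import Order.TTheory GRing.Theory Num.Theory.
Import numFieldNormedType.Exports.

Local Open Scope classical_set_scope.
Local Open Scope ring_scope.

(* The library provides the completeness and the norm of matrices separately. *)
HB.instance Definition _ (R : realType) (n : nat) :=
  Uniform_isComplete.Build 'rV[R]_n cauchy_cvg.

(** The slope is the difference quotient itself, or 0 when [u = v]. Its upper bound comes from the
    tangent inequality [1 + z <= expR z] at [z = u - v], so no derivative is taken. *)
Lemma inv_1DexpR_slope (R : realType) (u v : R) :
  exists2 c : R, 0 <= c <= 1 &
    (1 + expR u)^-1 - (1 + expR v)^-1 = c * (v - u).
Proof.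
wlog uv : u v / u < v.
  move=> wl; have [uv|vu|->] := ltgtP u v; first exact: wl.
    by have [c c01 e] := wl _ _ vu; exists c => //; lra.
  by exists 0; rewrite ?lexx ?ler01// !subrr mulr0.
have u0 := expR_gt0 u; have v0 := expR_gt0 v.
have D : expR u = expR v * expR (u - v) by rewrite -expRD subrKC.
have ge1 := expR_ge1Dx (u - v).
have lt_uv : expR u < expR v by rewrite ltr_expR.
have vu0 : 0 < v - u by rewrite subr_gt0.
have P0 : 0 < (1 + expR u) * (1 + expR v) by rewrite mulr_gt0// addr_gt0.
have E : (1 + expR u)^-1 - (1 + expR v)^-1 =
    (expR v - expR u) / ((1 + expR u) * (1 + expR v)).
  by field; apply/andP; split; lra.
exists ((expR v - expR u) / ((1 + expR u) * (1 + expR v)) / (v - u)).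
  apply/andP; split.
    by rewrite !divr_ge0// ltW// subr_gt0.
  rewrite ler_pdivrMr// mul1r ler_pdivrMr//.
  have le1 : expR v - expR u <= (v - u) * expR v by rewrite D; nra.
  apply: (le_trans le1); rewrite ler_pM2l//; nra.
by rewrite E divfK// gt_eqF.
Qed.

(** Exact linearization along the pair [x], [y]: the slopes depend on both points, but only their
    range matters. It serves both the contraction and the comparison. *)
Lemma elo_cl_sub (R : realType) (n : nat) (k : R) (p : 'M[R]_n)
    (x y : 'rV[R]_n) :
  exists2 c : 'I_n -> 'I_n -> R, (forall i j, 0 <= c i j <= 1) &
    forall i, elo_cl k y p 0 i - elo_cl k x p 0 i =
      - \sum_j k * (p i j + p j i) * c i j *
               ((y 0 i - x 0 i) - (y 0 j - x 0 j)).
Proof.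
pose P (ij : 'I_n * 'I_n) (c : R) := 0 <= c <= 1 /\
  (1 + expR (y 0 ij.2 - y 0 ij.1))^-1 - (1 + expR (x 0 ij.2 - x 0 ij.1))^-1 =
  c * ((y 0 ij.1 - x 0 ij.1) - (y 0 ij.2 - x 0 ij.2)).
have /choice[c cP] : forall ij, exists c, P ij c.
  move=> [i j]; have [c c01 e] :=
    inv_1DexpR_slope R (y 0 j - y 0 i) (x 0 j - x 0 i).
  by exists c; split=> //=; rewrite e; ring.
exists (fun i j => c (i, j)) => [i j|i]; first by have [] := cP (i, j).
rewrite !mxE -mulrBr -sumrB mulr_sumr -sumrN; apply: eq_bigr => j _.
have [_ /= e] := cP (i, j).
by rewrite -(mulrA _ (c _)) -e; ring.
Qed.

Lemma elo_cl_rating_space (R : realType) (n : nat) (k : R) (x : 'rV[R]_n)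
    (p : 'M[R]_n) : rating_space R n (elo_cl k x p).
Proof.
rewrite /rating_space /=; under eq_bigr do rewrite !mxE.
rewrite -mulr_sumr; set S := \sum_i _; suff -> : S = 0 by rewrite mulr0.
(* Exchanging the indices in one copy pairs the terms [(i, j)] and [(j, i)], which cancel because [1
   / (1 + expR u) + 1 / (1 + expR (- u)) = 1]. *)
suff : S + S = 0 by lra.
rewrite {2}/S exchange_big /= /S -big_split /= big1// => i _.
rewrite -big_split /= big1// => j _.
have u0 := expR_gt0 (x 0 j - x 0 i).
rewrite -(opprB (x 0 j)) expRN; field.
by rewrite !gt_eqF// addr_gt0.
Qed.

Lemma exists_elo (R : realType) (n : nat) (k : R) (hk : 0 < k) (p : 'M[R]_n)
    (hp : result_space R n p) :
  exists x : 'rV[R]_n, rating_space R n x /\ x = elo_cl k x p.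
Proof.
suff [x ex] : exists x, x = elo_cl k x p.
  by exists x; split=> //; rewrite ex; exact: elo_cl_rating_space.
have [p0 _] := hp.
have m0 i j : 0 <= k * (p i j + p j i) by rewrite mulr_ge0 ?addr_ge0// ltW.
pose M := \sum_i \sum_j k * (p i j + p j i).
have M0 : 0 <= M by apply: sumr_ge0 => i _; exact: sumr_ge0.
have leM i : \sum_j k * (p i j + p j i) <= M.
  rewrite [leRHS](bigD1 i)//= lerDl; apply: sumr_ge0 => l _; exact: sumr_ge0.
(* This choice gives [1 - t = t * M], and [M] bounds every row sum of the weights; hence the
   coefficient [1 - t - \sum_j w j] below is nonnegative. *)
pose t := (1 + M)^-1.
have tM : t * (1 + M) = 1 by rewrite mulVf// gt_eqF// ltr_wpDr.
have t0 : 0 < t by rewrite invr_gt0 ltr_wpDr.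
have t1 : 0 <= 1 - t by nra.
pose T (x : 'rV[R]_n) : 'rV[R]_n := (1 - t) *: x + t *: elo_cl k x p.
have T_lip x y : `|T y - T x| <= (1 - t) * `|y - x|.
  have coord_le (i : 'I_n) : `|y 0 i - x 0 i| <= `|y - x|.
    rewrite [leRHS]/Num.Def.normr /= mx_normrE; apply/bigmax_geP; right => /=.
    by exists (0, i); rewrite ?mxE.
  rewrite [leLHS]/Num.Def.normr /= mx_normrE; apply: bigmax_le => [|[z i] _].
    by rewrite mulr_ge0.
  rewrite /= ord1 {z}; have [c c01 e] := elo_cl_sub R n k p x y.
  pose w j := t * (k * (p i j + p j i) * c i j).
  have w0 j : 0 <= w j.
    by have /andP[c0 _] := c01 i j; rewrite mulr_ge0 ?(ltW t0)// mulr_ge0.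
  have w1 : \sum_j w j <= 1 - t.
    have -> : 1 - t = t * M by lra.
    rewrite -mulr_sumr ler_pM2l//; apply: le_trans (leM i); apply: ler_sum => j _.
    by have /andP[_ c1] := c01 i j; exact: ler_piMr.
  have -> : (T y - T x) 0 i = (1 - t - \sum_j w j) * (y 0 i - x 0 i) +
      \sum_j w j * (y 0 j - x 0 j).
    have -> : (T y - T x) 0 i = (1 - t) * (y 0 i - x 0 i) +
        t * (elo_cl k y p 0 i - elo_cl k x p 0 i).
      by rewrite /T !mxE; ring.
    rewrite e mulrN mulr_sumr.
    have -> : \sum_j t * (k * (p i j + p j i) * c i j *
               ((y 0 i - x 0 i) - (y 0 j - x 0 j))) =
       (\sum_j w j) * (y 0 i - x 0 i) - \sum_j w j * (y 0 j - x 0 j).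
      by rewrite mulr_suml -sumrB; apply: eq_bigr => j _; rewrite /w; ring.
    ring.
  apply: (le_trans (ler_normD _ _)).
  have -> : (1 - t) * `|y - x| = (1 - t - \sum_j w j) * `|y - x| +
      \sum_j w j * `|y - x| by rewrite -mulr_suml; ring.
  apply: lerD.
    by rewrite normrM ger0_norm ?subr_ge0// ler_wpM2l ?subr_ge0.
  apply: (le_trans (ler_norm_sum _ _ _)); apply: ler_sum => j _.
  by rewrite normrM ger0_norm// ler_wpM2l.
have Tfun : set_fun setT setT T by [].
pose F : {fun [set: 'rV[R]_n] >-> [set: 'rV[R]_n]} := mkfun_fun Tfun.
have [||x _ ex] := @banach_fixed_point R 'rV[R]_n setT F _ closedT.
- exists (NngNum t1); split=> [/=|[y x] _ /=]; first by lra.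
  exact: T_lip.
- by exists 0.
exists x; apply/(scalerI (lt0r_neq0 t0))/esym.
have {}ex : x = (1 - t) *: x + t *: elo_cl k x p by exact: ex.
by rewrite -[t *: elo_cl k x p](addKr ((1 - t) *: x)) -ex scalerBl scale1r
  opprB subrK.
Qed.

Lemma elo_spec (R : realType) (n : nat) (k : R) (hk : 0 < k) (p : 'M[R]_n)
    (hp : result_space R n p) :
  rating_space R n (elo k p) /\ elo k p = elo_cl k (elo k p) p.
Proof. exact: xgetPex (exists_elo R n k hk p hp). Qed.

(** Suppose [d a <= 0]. At a maximizer of [d] other than [a], the source is nonpositive and the
    subtracted sum nonnegative, so [d <= 0] everywhere. The zero sum then forces [d = 0], and the
    equation at [a] contradicts [0 < r a]. *)
Lemma maximum_principle (R : realFieldType) (n : nat) (a : 'I_n)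
    (d r : 'I_n -> R) (w : 'I_n -> 'I_n -> R) :
  (forall i j, 0 <= w i j) ->
  (forall i, d i = r i - \sum_j w i j * (d i - d j)) ->
  \sum_i d i = 0 -> 0 < r a -> (forall i, i != a -> r i <= 0) ->
  0 < d a.
Proof.
move=> w0 dE sum_d ra r0; rewrite ltNge; apply/negP => da.
have d_le0 : forall i, d i <= 0.
  case: (@Order.TotalTheory.arg_maxP _ R _ a xpredT d isT) => i0 _ max_i0 i.
  apply: (le_trans (max_i0 i isT)).
  have [->//|/r0 ri0] := eqVneq i0 a.
  rewrite dE subr_le0 (le_trans ri0)// sumr_ge0// => j _.
  by rewrite mulr_ge0// subr_ge0; exact: max_i0.
have d0 i : d i = 0.
  apply/eqP; rewrite -oppr_eq0; apply/eqP.
  by apply: (@psumr_eq0P _ _ xpredT (fun i => - d i)) => // [j _|];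
    rewrite ?oppr_ge0// sumrN sum_d oppr0.
have := dE a; rewrite d0 big1 => [|j _]; last by rewrite !d0 subrr mulr0.
by move/eqP; rewrite subr0 eq_sym gt_eqF.
Qed.

(** Only the terms indexed by [(a, b)] and [(b, a)] involve the changed entry; what [a] gains, [b]
    loses. *)
Lemma elo_cl_add_delta (R : realType) (n : nat) (k e : R) (p : 'M[R]_n)
    (y : 'rV[R]_n) (a b i : 'I_n) : a != b ->
  elo_cl k y (p + e *: delta_mx a b) 0 i - elo_cl k y p 0 i =
    k * e * (1 - (1 + expR (y 0 b - y 0 a))^-1) * ((i == a)%:R - (i == b)%:R).
Proof.
move=> ab; rewrite !mxE -mulrBr -sumrB -mulrA -mulrA; congr (k * _).
under eq_bigr do rewrite !mxE.
have ba : (b == a) = false by rewrite eq_sym (negbTE ab).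
have u0 := expR_gt0 (y 0 b - y 0 a).
have [->|ia] := eqVneq i a.
  rewrite (bigD1 b)//= big1 ?addr0 => [|j jb].
    rewrite !eqxx ba (negbTE ab) /=; ring.
  by rewrite (negbTE jb) (negbTE ab) /= !andbF !mulr0 !addr0 subrr.
have [->|ib] := eqVneq i b.
  rewrite (bigD1 a)//= big1 ?addr0 => [|j ja].
    rewrite !eqxx ?ba ?(negbTE ab) /= -(opprB (y 0 b)) expRN; field.
    by rewrite !gt_eqF// addr_gt0.
  by rewrite (negbTE ja) /= !mulr0 !addr0 subrr.
rewrite big1 => [|j _]; first by ring.
by rewrite ?(negbTE ia) ?(negbTE ib) /= andbF !mulr0 !addr0 subrr.
Qed.

Theorem proposition4p3 (R : realType) (n : nat) (hn : (2 <= n)%N)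
    (k : R) (hk : 0 < k) (p q : 'M[R]_n)
    (hp : result_space R n p) (hq : result_space R n q)
    (i' j' : 'I_n) (hlt : q i' j' > p i' j')
    (heq : forall i j : 'I_n, (i, j) <> (i', j') -> q i j = p i j) :
  elo k q 0 i' > elo k p 0 i' /\ elo k q 0 j' < elo k p 0 j'.
Proof.
have [p0 pd] := hp; have [_ qd] := hq.
(* Diagonal entries vanish in both matrices, so the increased entry is off the diagonal. *)
have ij : i' != j' by apply: contraTneq hlt => ->; rewrite pd qd ltxx.
pose e := q i' j' - p i' j'.
have e0 : 0 < e by rewrite subr_gt0.
have qE : q = p + e *: delta_mx i' j'.
  apply/matrixP => i j; rewrite !mxE.
  have [|/eqP ne] := boolP ((i, j) == (i', j')).
    by move=> /eqP[-> ->]; rewrite !eqxx mulr1 subrKC.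
  rewrite heq// -[(_ && _)]/((i, j) == (i', j')).
  by move/eqP/negbTE: ne => ->; rewrite mulr0 addr0.
have [xs xE] := elo_spec R n k hk p hp; have [ys yE] := elo_spec R n k hk q hq.
set x := elo k p in xs xE *; set y := elo k q in ys yE *.
have [c c01 cE] := elo_cl_sub R n k p x y.
pose g := k * e * (1 - (1 + expR (y 0 j' - y 0 i'))^-1).
have g0 : 0 < g.
  have u0 := expR_gt0 (y 0 j' - y 0 i').
  by rewrite /g !mulr_gt0// subr_gt0 invf_lt1 ?ltrDl// addr_gt0.
pose d i := y 0 i - x 0 i.
pose r i : R := g * ((i == i')%:R - (i == j')%:R).
pose w i j := k * (p i j + p j i) * c i j.
have w0 i j : 0 <= w i j.
  have /andP[c0 _] := c01 i j.
  by rewrite mulr_ge0// mulr_ge0 ?addr_ge0// ltW.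
have dE i : d i = r i - \sum_j w i j * (d i - d j).
  (* Insert [elo_cl k y p] between the two fixed points: changing the matrix at [y] yields the
     source, changing the rating at [p] yields the weighted sum. *)
  rewrite -(cE i) /r -(elo_cl_add_delta R n k e p y i' j' i ij) -qE.
  by rewrite /d {1}yE {1}xE; ring.
have sd : \sum_i d i = 0 by rewrite sumrB xs ys subrr.
have ji : j' != i' by rewrite eq_sym.
have ri : r i' = g by rewrite /r eqxx (negbTE ij) subr0 mulr1.
have rj : r j' = - g by rewrite /r eqxx (negbTE ji) sub0r mulrN1.
split.
  rewrite -subr_gt0; apply: (@maximum_principle R n i' d r w) => // [|i ii].
    by rewrite ri.
  rewrite /r (negbTE ii) sub0r mulrN oppr_le0.
  by rewrite mulr_ge0 ?ler0n// ltW.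
(* The equation is linear in [(d, r)], so negating both makes [j'] the only index with a positive
   source. *)
rewrite -subr_gt0 -opprB.
apply: (@maximum_principle R n j' (fun i => - d i) (fun i => - r i) w) =>
  // [i|||i ii].
- rewrite {1}dE opprD -!sumrN; congr (_ + _); apply: eq_bigr => j _; ring.
- by rewrite sumrN sd oppr0.
- by rewrite rj opprK.
- by rewrite /r (negbTE ii) subr0 oppr_le0 mulr_ge0 ?ler0n// ltW.
Qed.
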